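(* Let $\overline{\mathbb{D}}$ be the closed unit disk in $\mathbb{C}$ and define $$K_2=\{z\in\overline{\mathbb{D}}:|z-(-1+i)|\le1\},\qquad K_j=-i\,K_{j-1}\ \text{ for }j=3,4,5,$$ and let $K_1$ be the closure of $\overline{\mathbb{D}}\setminus(K_2\cup K_3\cup K_4\cup K_5)$. Then the disk algorithm (whose fundamental set is $K=\overline{\mathbb{D}}$) satisfies the finite building property with $\mathcal{P}=\{K_1,\dots,K_5\}$.
   Context: Here $i=\sqrt{-1}$ and $\alpha=1+i$. Define subsets of the closed unit disk: $V_0=\overline{\mathbb{D}}$; $V_1=\{w\in\overline{\mathbb{D}}:|w+\alpha|\ge1\}$; $V_j=-i\,V_{j-1}$ for $j=2,3,4$; $V_5=V_1\cap V_2$; $V_j=-i\,V_{j-1}$ for $j=6,7,8$. Let $E=\{x+yi\in\mathbb{Z}[i]:x+y\text{ even}\}$, partitioned into $E_0=\{0\}$; $E_1=\{n\alpha:n>0\}$; $E_j=-i\,E_{j-1}$ for $j=2,3,4$; $E_5=\{n\alpha+m\overline{\alpha}:n,m>0\}$; $E_j=-i\,E_{j-1}$ for $j=6,7,8$ ($n,m$ integers). For $a\in E$ let $V(a)=V_j$ where $a\in E_j$. The disk algorithm is the choice function with $\lfloor w\rceil=a\in E$ if $w\in a+V(a)$ (with any convention on the null set of boundary points lying in several of these sets). The Gauss map $G:K\to K$ on $K=\overline{\mathbb{D}}$ is $G(z)=-1/z-\lfloor-1/z\rceil$ for $z\neq0$, $G(0)=0$. A finite partition of $K$ is a finite collection of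 closed sets with boundaries of zero Lebesgue measure and pairwise disjoint interiors whose union is $K$. A set is buildable from a collection $\mathcal{C}$ of closed sets (with null boundaries) if it is equal, up to measure zero, to some union of elements of $\mathcal{C}$. The algorithm satisfies the finite building property with $\mathcal{P}=\{K_1,\dots,K_N\}$ if $N>1$, $\mathcal{P}$ is a finite partition of $K$, and each $G(K_j)$ is buildable from $\mathcal{P}$. *)

(* Defs.v *)
From HB Require Import structures.
From mathcomp Require Import all_boot all_order all_algebra.
From mathcomp Require Import complex.
From mathcomp Require Import all_classical all_reals all_analysis.
Set Implicit Arguments.
Unset Strict Implicit.
Unset Printing Implicit Defensive.
Import Order.TTheory GRing.Theory Num.Theory numFieldNormedType.Exports.
Local Open Scope classical_set_scope.
Local Open Scope ring_scope.

(* [R[i]] itself carries no topology; its regular module [R[i]^o] has the one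
   induced by the modulus, through the numFieldType structure of [R[i]]. *)
Notation Cplx R := ((R[i])^o).

Definition null_set (R : realType) (A : set (Cplx R)) : Prop :=
  (lebesgue_measure \x lebesgue_measure)%E.-negligible
    [set p : R * R | A (p.1 +i* p.2)%C].

Definition boundary (R : realType) (A : set (Cplx R)) : set (Cplx R) :=
  closure A `\` interior A.

Definition finite_partition (R : realType) (K : set (Cplx R)) (N : nat)
    (P : 'I_N -> set (Cplx R)) : Prop :=
  [/\ forall j, closed (P j),
      forall j, null_set (boundary (P j)),
      forall i j, i != j -> interior (P i) `&` interior (P j) = set0 &
      \bigcup_j P j = K].

Definition buildable (R : realType) (CC : set (set (Cplx R)))
    (A : set (Cplx R)) : Prop :=
  exists2 U : set (set (Cplx R)), U `<=` CC &
    null_set (A `+` \bigcup_(X in U) X).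

Definition gauss_map (R : realType) (floor : Cplx R -> Cplx R) (z : Cplx R) :
    Cplx R :=
  if z == 0 then 0 else - z^-1 - floor (- z^-1).

Definition finite_building_property (R : realType) (K : set (Cplx R))
    (floor : Cplx R -> Cplx R) (N : nat) (P : 'I_N -> set (Cplx R)) : Prop :=
  [/\ (1 < N)%N,
      finite_partition K P &
      forall j, buildable (range P) (gauss_map floor @` P j)].

Definition cdisk (R : realType) : set (Cplx R) := [set z | `|z| <= 1].

Definition alpha (R : realType) : Cplx R := (1 +i* 1)%C.

Definition alphabar (R : realType) : Cplx R := ((alpha R)^*)%C.

Definition rot (R : realType) (A : set (Cplx R)) : set (Cplx R) :=
  [set (- 'i%C) * z | z in A].

Definition V1 (R : realType) : set (Cplx R) :=
  @cdisk R `&` [set w | 1 <= `|w + alpha R|].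

Definition V_ (R : realType) (j : nat) : set (Cplx R) :=
  match j with
  | 0 => @cdisk R
  | 1 | 2 | 3 | 4 => iter (j - 1) (@rot R) (@V1 R)
  | _ => iter (j - 5) (@rot R) (@V1 R `&` rot (@V1 R))
  end.

Definition even_gauss (R : realType) : set (Cplx R) :=
  [set z | exists x y : int, (2 %| x + y)%Z /\ z = (x%:~R +i* y%:~R)%C].

Definition E1 (R : realType) : set (Cplx R) :=
  [set a | exists n : nat, (0 < n)%N /\ a = alpha R *+ n].

Definition E5 (R : realType) : set (Cplx R) :=
  [set a | exists n m : nat,
    [/\ (0 < n)%N, (0 < m)%N & a = alpha R *+ n + alphabar R *+ m]].

Definition E_ (R : realType) (j : nat) : set (Cplx R) :=
  match j with
  | 0 => [set 0]
  | 1 | 2 | 3 | 4 => iter (j - 1) (@rot R) (@E1 R)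
  | _ => iter (j - 5) (@rot R) (@E5 R)
  end.

(* V(a) = V_j for the unique j <= 8 with a in E_j. *)
Definition V_of (R : realType) (a : Cplx R) : set (Cplx R) :=
  [set w | exists j : nat, [/\ (j <= 8)%N, E_ j a & V_ j w]].

(* A point lying in several tiles a + V(a) may be sent to any of the
   corresponding a, so this holds exactly of the versions of the disk algorithm
   given by all possible conventions on the boundaries of the tiles. *)
Definition disk_algorithm (R : realType) (floor : Cplx R -> Cplx R) : Prop :=
  forall w, even_gauss (floor w) /\ V_of (floor w) (w - floor w).

Definition K2 (R : realType) : set (Cplx R) :=
  @cdisk R `&` [set z | `|z - (- 1 +i* 1)%C| <= 1].

Definition K_ (R : realType) (j : nat) : set (Cplx R) :=
  let lens k := iter (k - 2) (@rot R) (@K2 R) in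
  if j == 1%N then
    closure (@cdisk R `\` (lens 2%N `|` lens 3%N `|` lens 4%N `|` lens 5%N))
  else lens j.

(* Ordinals start at 0: the piece of index j is K_(j+1). *)
Definition disk_pieces (R : realType) (j : 'I_5) : set (Cplx R) := @K_ R j.+1.

(* Main.v *)
(* Let [alpha = 1 + i]. The disk tiles [a + V(a)] are cut out by unit circles
   centred at the even Gaussian integers [n alpha + m alphabar], and off this
   null union of circles every point lies in exactly one tile. The map
   [z |-> - 1 / z] sends the circle at a point [c] with [|c|^2 = 2] to the circle
   at [- c^*], so it maps the lens at [c] onto the part outside the unit disk of
   the disk at [- c^*], which is the tile of [- c^*]. Hence, up to measure zero,
   [G] maps this lens onto the unit disk minus the lens at [c^*], i.e. the union
   of the four other pieces. The central piece is mapped to the points lying in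
   no disk at [0], [+- alpha], [+- alphabar]; this region contains the tiles of
   [+- 2 alpha], whose translates to [0] already cover the unit disk. *)
Require Import Defs.
From mathcomp Require Import all_boot all_order all_algebra.
From mathcomp Require Import complex ring lra zify.
From mathcomp Require Import all_classical all_reals all_analysis.
From mathcomp Require Import measurable_realfun.
Set Implicit Arguments.
Unset Strict Implicit.
Unset Printing Implicit Defensive.
Import Order.TTheory GRing.Theory Num.Theory numFieldNormedType.Exports.
Local Open Scope classical_set_scope.
Local Open Scope ring_scope.

(** By Fubini: each vertical section has at most two points. *)
Lemma negligible_circle (R : realType) (a b r : R) :
  (lebesgue_measure \x lebesgue_measure)%E.-negligible
    [set p : R * R | (p.1 - a) ^+ 2 + (p.2 - b) ^+ 2 = r].
Proof.
set C := [set p : R * R | _].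
have mC : measurable C.
  have -> : C = setT `&`
      (fun p : R * R => (p.1 - a) ^+ 2 + (p.2 - b) ^+ 2) @^-1` [set r].
    by rewrite setTI.
  have mf : measurable_fun setT
      (fun p : R * R => (p.1 - a) ^+ 2 + (p.2 - b) ^+ 2).
    by apply: measurable_funD; apply: measurable_funX; apply: measurable_funB.
  exact: mf.
apply/negligibleP => //=.
rewrite /product_measure1; apply: integral0_eq => x _ /=.
apply: countable_lebesgue_measure0; apply: finite_set_countable.
set s := Num.sqrt (r - (x - a) ^+ 2).
apply: (@sub_finite_set _ _ [set b + s; b - s]) => [y|]; last exact: finite_set2.
rewrite /xsection/= inE /C/= => Cxy.
have : (y - b) ^+ 2 = s ^+ 2.
  rewrite /s sqr_sqrtr; first by rewrite -Cxy; ring.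
  by rewrite -Cxy addrAC subrr add0r sqr_ge0.
by move/eqP; rewrite eqf_sqr => /orP[]/eqP e; [left|right]; rewrite -e; ring.
Qed.

(** * Squared moduli and integer coordinates *)

Section DiskAlgorithm.
Variable R : realType.
Implicit Types (z w v c : Cplx R) (n m : int) (A : set (Cplx R)).

(** The modulus takes its values in [R[i]]; this real polynomial in the coordinates is within reach
    of [lra] and [field]. *)
Definition normsq z : R := complex.Re z ^+ 2 + complex.Im z ^+ 2.

(* [n alpha + m alphabar], so that [lat] enumerates the even Gaussian integers. *)
Definition lat n m : Cplx R := ((n + m)%:~R +i* (n - m)%:~R)%C.

Lemma normE z : `|z| = (Num.sqrt (normsq z))%:C%C.
Proof. by case: z. Qed.

Lemma normsq_ge0 z : 0 <= normsq z.
Proof. by rewrite addr_ge0 ?sqr_ge0. Qed.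

Lemma norm_le1 z : (`|z| <= 1) = (normsq z <= 1).
Proof. by rewrite normE lecR -{1}sqrtr1 ler_sqrt. Qed.

Lemma norm_ge1 z : (1 <= `|z|) = (1 <= normsq z).
Proof. by rewrite normE lecR -{1}sqrtr1 ler_sqrt ?normsq_ge0. Qed.

(** The image under multiplication by $-i$ is the preimage under its inverse, multiplication by
    $i$. *)
Lemma rotE A (x y : R) : Defs.rot A (x +i* y)%C = A (- y +i* x)%C.
Proof.
have iK z : 'i%C * (- 'i%C * z) = z.
  by rewrite mulrA mulrN -expr2 sqr_i opprK mul1r.
have Ki z : - 'i%C * ('i%C * z) = z.
  by rewrite mulrA mulNr -expr2 sqr_i opprK mul1r.
have iE : 'i%C * (x +i* y)%C = (- y +i* x)%C by simpc.
apply/propext; rewrite -iE; split=> [[w Aw <-]|Aiz]; first by rewrite iK.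
by exists ('i%C * (x +i* y)%C).
Qed.

(** * Tiles in the coordinates [(n, m)] *)

Lemma alpha_mulrn (n : nat) : alpha R *+ n = (n%:R +i* n%:R)%C.
Proof.
elim: n => [|n IH]; first by rewrite mulr0n.
by rewrite mulrS IH /alpha; simpc; rewrite -!natr1 addrC.
Qed.

Lemma alphabar_mulrn (n : nat) : alphabar R *+ n = (n%:R +i* - n%:R)%C.
Proof.
elim: n => [|n IH]; first by rewrite ?mulr0n oppr0.
by rewrite mulrS IH /alphabar /alpha; simpc;
  rewrite -!natr1 opprD !(addrC 1) (addrC (-1)).
Qed.

(* The tile [a + V(a)] of [a = lat n m] is the disk at [a] minus the open disks
   at those of its neighbours that are closer to 0 in the coordinates [(n, m)]. *)
Definition tile n m w :=
  [/\ normsq (w - lat n m) <= 1,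
   0 < n -> 1 <= normsq (w - lat (n - 1) m),
   n < 0 -> 1 <= normsq (w - lat (n + 1) m),
   0 < m -> 1 <= normsq (w - lat n (m - 1)) &
   m < 0 -> 1 <= normsq (w - lat n (m + 1))].

Lemma normsq_sub (x y p q : R) :
  normsq ((x +i* y)%C - (p +i* q)%C : Cplx R) = (x - p) ^+ 2 + (y - q) ^+ 2.
Proof. by []. Qed.

Lemma V1E (x y : R) : V1 (x +i* y)%C ->
  x ^+ 2 + y ^+ 2 <= 1 /\ 1 <= (x + 1) ^+ 2 + (y + 1) ^+ 2.
Proof. by rewrite /V1/= /cdisk/= norm_le1 norm_ge1. Qed.

Lemma E1E (x y : R) : E1 (x +i* y)%C ->
  exists n : nat, [/\ (0 < n)%N, x = n%:R & y = n%:R].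
Proof. by move=> [n [n0]]; rewrite alpha_mulrn => -[-> ->]; exists n. Qed.

Lemma E5E (x y : R) : E5 (x +i* y)%C ->
  exists n m : nat, [/\ (0 < n)%N, (0 < m)%N, x = n%:R + m%:R & y = n%:R - m%:R].
Proof.
by move=> [n [m [n0 m0]]]; rewrite alpha_mulrn alphabar_mulrn => -[-> ->]; exists n, m.
Qed.

(** Common form of the nine cases of $V(a)$: a unit step in [n] moves the centre by $1+i$, one in
    [m] by $1-i$. *)
Lemma exists_tile (x y p q : R) n m :
  p = n%:~R + m%:~R -> q = n%:~R - m%:~R ->
  let u := x - p in let v := y - q in
  [/\ u ^+ 2 + v ^+ 2 <= 1,
      0 < n -> 1 <= (u + 1) ^+ 2 + (v + 1) ^+ 2,
      n < 0 -> 1 <= (u - 1) ^+ 2 + (v - 1) ^+ 2,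
      0 < m -> 1 <= (u + 1) ^+ 2 + (v - 1) ^+ 2 &
      m < 0 -> 1 <= (u - 1) ^+ 2 + (v + 1) ^+ 2] ->
  exists n' m', (p +i* q)%C = lat n' m' /\ tile n' m' (x +i* y)%C.
Proof.
move=> -> -> u v tuv; exists n, m; split; first by rewrite /lat rmorphD rmorphB.
rewrite /tile /lat !normsq_sub !(rmorphB, rmorphD, rmorphN) /= -/u -/v.
have -> : x - (n%:~R - 1 + m%:~R) = u + 1 by rewrite /u; ring.
have -> : x - (n%:~R + 1 + m%:~R) = u - 1 by rewrite /u; ring.
have -> : x - (n%:~R + (m%:~R - 1)) = u + 1 by rewrite /u; ring.
have -> : x - (n%:~R + (m%:~R + 1)) = u - 1 by rewrite /u; ring.
have -> : y - (n%:~R - 1 - m%:~R) = v + 1 by rewrite /v; ring.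
have -> : y - (n%:~R + 1 - m%:~R) = v - 1 by rewrite /v; ring.
have -> : y - (n%:~R - (m%:~R - 1)) = v - 1 by rewrite /v; ring.
by have -> : y - (n%:~R - (m%:~R + 1)) = v + 1 by rewrite /v; ring.
Qed.

Local Ltac tile_bounds :=
  rewrite ?mulrNz ?addr0 ?subr0 -?pmulrn; cbv zeta; try lra;
  split => [|?|?|?|?]; try lra; exfalso; lia.

Lemma tile_of_V w a : V_of a (w - a) ->
  exists n m, a = lat n m /\ tile n m w.
Proof.
move=> [j [jle]]; case: w a => x y [p q].
have -> : (x +i* y)%C - (p +i* q)%C = ((x - p) +i* (y - q))%C by [].
move: j jle => [|[|[|[|[|[|[|[|[|//]]]]]]]]] _.
- move=> [pE qE]; rewrite /= /cdisk/= norm_le1 => H.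
  by apply: (exists_tile (n := 0) (m := 0)); rewrite ?addr0 ?subr0.
all: cbn [E_ V_ iter subn Nat.sub] => /=;
  rewrite ?setIE/= ?rotE/= ?opprK ?rotE ?opprK.
(* As $-i\alpha=\overline\alpha$ and $-i\overline\alpha=-\alpha$, each rotation sends [(n, m)] to
   [(- m, n)]; this gives the witnesses below. *)
- move=> /E1E[n [n0 pE qE]] /V1E[d1 d2].
  apply: (exists_tile (n := n%:Z) (m := 0)); tile_bounds.
- move=> /E1E[n [n0 pE qE]] /V1E[d1 d2].
  apply: (exists_tile (n := 0) (m := n%:Z)); tile_bounds.
- move=> /E1E[n [n0 pE qE]] /V1E[d1 d2].
  apply: (exists_tile (n := - n%:Z) (m := 0)); tile_bounds.
- move=> /E1E[n [n0 pE qE]] /V1E[d1 d2].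
  apply: (exists_tile (n := 0) (m := - n%:Z)); tile_bounds.
- move=> /E5E[n [m [n0 m0 pE qE]]] [/V1E[d1 d2] /V1E[_ d3]].
  apply: (exists_tile (n := n%:Z) (m := m%:Z)); tile_bounds.
- move=> /E5E[n [m [n0 m0 pE qE]]] [/V1E[d1 d2] /V1E[_ d3]].
  apply: (exists_tile (n := - m%:Z) (m := n%:Z)); tile_bounds.
- move=> /E5E[n [m [n0 m0 pE qE]]] [/V1E[d1 d2] /V1E[_ d3]].
  apply: (exists_tile (n := - n%:Z) (m := - m%:Z)); tile_bounds.
- move=> /E5E[n [m [n0 m0 pE qE]]] [/V1E[d1 d2] /V1E[_ d3]].
  apply: (exists_tile (n := m%:Z) (m := - n%:Z)); tile_bounds.
Qed.

(** * Uniqueness of tiles off the circles *)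

Definition circles : set (Cplx R) :=
  [set v | exists n m, normsq (v - lat n m) = 1].

(** Parallelogram identity: the squared distance of the centres, twice the left side, is at most
    twice the sum of their squared distances to [w], so less than 4. The two squares in the proof
    make up the other diagonal. *)
Lemma lat_near n m n' m' w : normsq (w - lat n m) < 1 ->
  normsq (w - lat n' m') <= 1 -> (n' - n) ^+ 2 + (m' - m) ^+ 2 < 2 :> int.
Proof.
case: w => x y; rewrite /lat !normsq_sub => d d'.
rewrite -(ltr_int R) !(rmorphD, rmorphB, rmorphN, rmorphXn) /=.
move: d d'; rewrite !(rmorphD, rmorphB, rmorphN) /=.
set N := n%:~R; set M := m%:~R; set N' := n'%:~R; set M' := m'%:~R => d d'.
have := sqr_ge0 (2 * x - (N + M) - (N' + M')).
have := sqr_ge0 (2 * y - (N - M) - (N' - M')).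
by lra.
Qed.

Lemma not_circles_lt v n m : ~ circles v -> normsq (v - lat n m) <= 1 ->
  normsq (v - lat n m) < 1.
Proof.
move=> vC; rewrite le_eqVlt => /orP[/eqP e|//].
by case: vC; exists n, m.
Qed.

Lemma sqr_sum_lt2 (k l : int) : k ^+ 2 + l ^+ 2 < 2 ->
  (k = 0 /\ l = 0) \/ (k = 1 /\ l = 0) \/ (k = -1 /\ l = 0) \/
  (k = 0 /\ l = 1) \/ (k = 0 /\ l = -1).
Proof.
have small (j : int) : j ^+ 2 < 2 -> j = -1 \/ j = 0 \/ j = 1.
  by rewrite expr2 => j2; have : -1 <= j <= 1; [nia|lia].
move=> kl; have [k2 l2] : k ^+ 2 < 2 /\ l ^+ 2 < 2.
  have := sqr_ge0 k; have := sqr_ge0 l; lra.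
by move: kl; have [->|[->|->]] := small _ k2;
  have [->|[->|->]] := small _ l2 => // _; tauto.
Qed.

(** By [lat_near] the two centres are equal or neighbours; of two neighbours, the tile of the one
    farther from 0 avoids the open disk at the other. *)
Lemma tile_uniq n m n' m' w : ~ circles w -> tile n m w -> tile n' m' w ->
  n = n' /\ m = m'.
Proof.
move=> wC [/(not_circles_lt wC) d tN tn tM tm].
move=> [/(not_circles_lt wC) d' tN' tn' tM' tm'].
have near := lat_near d (ltW d').
have [H|[H|[H|[H|H]]]] : (n' = n /\ m' = m) \/ (n' = n + 1 /\ m' = m) \/
  (n' = n - 1 /\ m' = m) \/ (n' = n /\ m' = m + 1) \/ (n' = n /\ m' = m - 1).
  by move/sqr_sum_lt2: near; clear; lia.
- by case: H.
- move: H => [En Em]; subst n' m'; exfalso.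
  (* The sign of the coordinate decides which of the two tiles excludes the other disk. *)
  have [/tN'|/tn] : 0 < n + 1 \/ n < 0 by clear; lia.
    by rewrite addrK leNgt d.
  by rewrite leNgt d'.
- move: H => [En Em]; subst n' m'; exfalso.
  have [/tN|/tn'] : 0 < n \/ n - 1 < 0 by clear; lia.
    by rewrite leNgt d'.
  by rewrite subrK leNgt d.
- move: H => [En Em]; subst n' m'; exfalso.
  have [/tM'|/tm] : 0 < m + 1 \/ m < 0 by clear; lia.
    by rewrite addrK leNgt d.
  by rewrite leNgt d'.
- move: H => [En Em]; subst n' m'; exfalso.
  have [/tM|/tm'] : 0 < m \/ m - 1 < 0 by clear; lia.
    by rewrite leNgt d'.
  by rewrite subrK leNgt d.
Qed.

(** * The tiles of 0, of the unit vectors and of their doubles *)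

Lemma lat00 : lat 0 0 = 0.
Proof. by []. Qed.

Lemma tile0 w : normsq w <= 1 -> tile 0 0 w.
Proof. by move=> w1; split=> //; rewrite lat00 subr0. Qed.

(** Coordinates of the lattice points $\pm\alpha$, $\pm\overline\alpha$, of squared modulus 2. *)
Definition unitv n m := (`|n| + `|m| = 1)%N.

Lemma unitvP n m : unitv n m ->
  [\/ n = 1 /\ m = 0, n = -1 /\ m = 0, n = 0 /\ m = 1 | n = 0 /\ m = -1].
Proof.
rewrite /unitv => nm.
have [H|[H|[H|H]]] : (n = 1 /\ m = 0) \/ (n = -1 /\ m = 0) \/
  (n = 0 /\ m = 1) \/ (n = 0 /\ m = -1) by lia.
- by constructor 1.
- by constructor 2.
- by constructor 3.
- by constructor 4.
Qed.

Lemma tile1 n m w : unitv n m -> 1 <= normsq w -> normsq (w - lat n m) <= 1 ->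
  tile n m w.
Proof.
by move=> /unitvP[] [-> ->] w1 wd; split=> // _;
  rewrite ?subrr ?addNr ?lat00 ?subr0.
Qed.

(** The unit vector is the only neighbour of its double that is closer to 0. *)
Lemma tile2 n m w : unitv n m -> 1 <= normsq (w - lat n m) ->
  normsq (w - lat (n *+ 2) (m *+ 2)) <= 1 -> tile (n *+ 2) (m *+ 2) w.
Proof.
by move=> /unitvP[] [-> ->] w1 wd; split=> // _; rewrite ?mul0rn ?mulr2n ?addrK ?addrNK.
Qed.

(** * The inversion $z\mapsto-1/z$ on circles *)

Lemma complexV (x y : R) : - ((x +i* y)%C : Cplx R)^-1 =
  ((- (x / (x ^+ 2 + y ^+ 2))) +i* (y / (x ^+ 2 + y ^+ 2)))%C.
Proof.
have -> : ((x +i* y)%C : Cplx R)^-1 =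
  ((x / (x ^+ 2 + y ^+ 2)) -i* (y / (x ^+ 2 + y ^+ 2)))%C by [].
by rewrite -[RHS]/((- (x / (x ^+ 2 + y ^+ 2))) +i* (y / (x ^+ 2 + y ^+ 2)))%C
   /GRing.opp /= opprK.
Qed.

Lemma normsq_eq0 z : (normsq z == 0) = (z == 0).
Proof. by case: z => x y; rewrite /normsq paddr_eq0 ?sqr_ge0 // !sqrf_eq0 eq_complex. Qed.

(** For [c = lat n m], [lat (- m) (- n)] is $-\overline c$. As $|c|^2=2$, both sides expand to
    $(|z|^2+2\,\mathrm{Re}(cz)+1)/|z|^2$. *)
Lemma normsq_inv z n m : unitv n m -> z != 0 ->
  normsq (- z^-1 - lat n m) - 1 = (normsq (z - lat (- m) (- n)) - 1) / normsq z.
Proof.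
rewrite -normsq_eq0; case: z => x y nm; rewrite {1}/normsq /= => z0.
rewrite complexV /lat !normsq_sub !(rmorphD, rmorphN, rmorphB) /= /normsq /=.
by move/unitvP: nm => [] [-> ->]; rewrite ?rmorphN ?rmorph1 ?rmorph0; field.
Qed.

Lemma normsqV z : normsq (- z^-1) = (normsq z)^-1.
Proof.
(* At 0 both sides vanish, since the inverse of 0 is 0. *)
have [->|] := eqVneq z 0; first by rewrite invr0 oppr0 /normsq /= expr0n addr0 invr0.
rewrite -normsq_eq0; case: z => x y; rewrite complexV /normsq /= => z0.
by field.
Qed.

(** * Topology of disks and circles *)

Lemma norm_lt1 z : (`|z| < 1) = (normsq z < 1).
Proof. by rewrite normE ltcR -{1}sqrtr1 ltr_sqrt. Qed.

Lemma norm_gt1 z : (1 < `|z|) = (1 < normsq z).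
Proof.
rewrite normE ltcR; apply/idP/idP => [h|h]; last first.
  by rewrite -sqrtr1 ltr_sqrt // (lt_trans _ h).
by rewrite ltNge; apply: contraTN h => h; rewrite -leNgt -sqrtr1 ler_sqrt.
Qed.

Lemma open_normsq_lt1 c : open [set z | normsq (z - c) < 1].
Proof.
have -> : [set z | normsq (z - c) < 1] = ball c 1.
  by apply/seteqP; split=> z; rewrite -ball_normE /= -norm_lt1 distrC.
exact: ball_open.
Qed.

Lemma open_normsq_gt1 c : open [set z | 1 < normsq (z - c)].
Proof.
rewrite openE => z /=; rewrite -norm_gt1 => z1.
apply/nbhs_ballP; exists (`|z - c| - 1); rewrite /= ?subr_gt0 // => y.
rewrite -ball_normE /= -norm_gt1 => zy.
have := ler_distD y z c; rewrite -lerBlDl => /(lt_le_trans _); apply.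
by rewrite ltrBrDl -ltrBrDr.
Qed.

Lemma closed_normsq_le1 c : closed [set z | normsq (z - c) <= 1].
Proof.
have -> : [set z | normsq (z - c) <= 1] = ~` [set z | 1 < normsq (z - c)].
  by apply/seteqP; split=> z /=; rewrite leNgt => /negP.
exact/open_closedC/open_normsq_gt1.
Qed.

Lemma closed_normsq_ge1 c : closed [set z | 1 <= normsq (z - c)].
Proof.
have -> : [set z | 1 <= normsq (z - c)] = ~` [set z | normsq (z - c) < 1].
  by apply/seteqP; split=> z /=; rewrite leNgt => /negP.
exact/open_closedC/open_normsq_lt1.
Qed.

(* Moving radially away from the centre leaves the circle. *)
Lemma circle_interior_disjoint A (B : set (Cplx R)) c :
  (forall z, A z -> B z -> normsq (z - c) = 1) ->
  interior A `&` interior B = set0.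
Proof.
move=> AB; apply/seteqP; split=> // z [Az Bz].
have /nbhs_ballP[e /= e0 zAB] : nbhs z (A `&` B) by apply: filterI.
have norm1 y : A y -> B y -> `|y - c| = 1.
  by move=> Ay By; rewrite normE AB // sqrtr1.
have z1 : `|z - c| = 1 by apply: norm1; apply: nbhs_singleton.
have e2 : 0 < e / 2 by rewrite divr_gt0.
have [Ay By] : (A `&` B) (z + e / 2 * (z - c)).
  apply: zAB; rewrite -ball_normE /= opprD addNKr normrN normrM z1 mulr1.
  by rewrite gtr0_norm // ltr_pdivrMr // ltr_pMr // ltr1n.
have := norm1 _ Ay By; rewrite addrAC -[X in X + _]mul1r -mulrDl normrM z1 mulr1.
rewrite ger0_norm; last by rewrite addr_ge0 // ltW.
by move/eqP; rewrite -subr_eq0 addrC addKr gt_eqF.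
Qed.

(** * Equality up to measure zero *)

Lemma null_circles A : A `<=` circles -> Defs.null_set A.
Proof.
pose C (p : int * int) : set (R * R) :=
  [set q | (q.1 - (p.1 + p.2)%:~R) ^+ 2 + (q.2 - (p.1 - p.2)%:~R) ^+ 2 = 1].
(* Enumerates the countably many circles; an index coding no centre gives the empty set. *)
pose F k := if unpickle k is Some p then C p else set0.
move=> AC.
have FN : (lebesgue_measure \x lebesgue_measure)%E.-negligible (\bigcup_k F k).
  apply: negligible_bigcup => k; rewrite /F; case: unpickle => [p|].
    exact: negligible_circle.
  exact: negligible_set0.
case: FN => N [mN N0 FN]; exists N; split=> //; apply: subset_trans FN => q.
move=> /AC[n [m e]]; exists (pickle (n, m)); first exact: I.
by rewrite /F pickleK; exact: e.
Qed.

(** Reduces equality up to measure zero to a pointwise check off [circles]. *)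
Lemma null_setY A (B : set (Cplx R)) :
  (forall v, ~ circles v -> A v <-> B v) -> Defs.null_set (A `+` B).
Proof.
move=> AB; apply: null_circles => v ABv; apply: contrapT => /AB[AtoB BtoA].
by case: ABv => -[]; tauto.
Qed.

Lemma latD n m n' m' : lat (n + n') (m + m') = lat n m + lat n' m'.
Proof.
rewrite -[RHS]/(((n + m)%:~R + (n' + m')%:~R) +i* ((n - m)%:~R + (n' - m')%:~R))%C.
by rewrite /lat -!rmorphD /=; congr (_%:~R +i* _%:~R)%C; ring.
Qed.

Lemma latN n m : lat (- n) (- m) = - lat n m.
Proof. by apply/eqP; rewrite -addr_eq0 -latD !addNr. Qed.

Lemma circlesD v n m : circles (v + lat n m) -> circles v.
Proof.
move=> [p [q e]]; exists (p - n), (q - m).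
by rewrite latD latN opprD opprK addrA addrAC.
Qed.

(** * The five pieces form a finite partition *)

Definition lens n m : set (Cplx R) :=
  [set z | normsq z <= 1 /\ normsq (z - lat n m) <= 1].

(* [disk_pieces j] is the lens [K_(j+1)]; the value at [ord0] is a dummy. *)
Definition center (j : 'I_5) : int * int :=
  nth (0, 0) [:: (0, 0); (0, -1); (1, 0); (0, 1); (-1, 0)] j.

Lemma center_unitv j : j != ord0 -> unitv (center j).1 (center j).2.
Proof. by case: j => [[|[|[|[|[|]]]]]]. Qed.

Lemma center_inj : injective center.
Proof.
by move=> [[|[|[|[|[|//]]]]] hi] [[|[|[|[|[|//]]]]] hj] //= _; apply: val_inj.
Qed.

Lemma unitv_center n m : unitv n m ->
  exists j, j != ord0 /\ center j = (n, m).
Proof.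
by case/unitvP => [] [-> ->];
  [exists (inord 2)|exists (inord 4)|exists (inord 3)|exists (inord 1)];
  rewrite /center -val_eqE /= inordK.
Qed.

(** $K_2$ is centred at $-1+i$, which is [lat 0 (-1)]; the other centres follow by the rotation
    [(n, m)] to [(- m, n)]. *)
Lemma pieces_lens j : j != ord0 ->
  disk_pieces j = lens (center j).1 (center j).2.
Proof.
move=> j0; apply/seteqP; split=> -[x y] /=.
all: move: j j0 => [[|[|[|[|[|//]]]]] hj] //= _.
all: rewrite /disk_pieces /K_ /lens /center /=.
all: rewrite ?rotE ?opprK ?rotE ?opprK ?rotE ?opprK /K2 /= /cdisk /= !norm_le1.
all: rewrite /lat /normsq /=.
all: rewrite ?(oppr0, opprK, addr0, add0r, rmorph1, rmorphN).
all: case=> d1 d2; split; lra.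
Qed.

Definition off_lenses : set (Cplx R) :=
  [set z | normsq z <= 1 /\
    forall n m, unitv n m -> 1 < normsq (z - lat n m)].

Lemma pieces0E : @disk_pieces R ord0 = closure off_lenses.
Proof.
have -> : @disk_pieces R ord0 = closure (@cdisk R `\`
  (disk_pieces (@Ordinal 5 1 isT) `|` disk_pieces (@Ordinal 5 2 isT) `|`
   disk_pieces (@Ordinal 5 3 isT) `|` disk_pieces (@Ordinal 5 4 isT))) by [].
congr closure; rewrite !pieces_lens //.
apply/seteqP; split=> z; rewrite /lens /center /cdisk /= norm_le1.
  move=> [z1 zU]; split=> // n m nm; rewrite ltNge; apply/negP => znm; apply: zU.
  by case/unitvP: nm => [] [nE mE]; rewrite nE mE in znm; tauto.
move=> [z1 zgt]; split=> //.
by move=> [[[|]|]|] [_]; rewrite leNgt zgt.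
Qed.

Lemma pieces0_sub z : disk_pieces ord0 z ->
  normsq z <= 1 /\ forall n m, unitv n m -> 1 <= normsq (z - lat n m).
Proof.
rewrite pieces0E => cz; split=> [|n m nm].
  rewrite -[z]subr0; apply: (closed_normsq_le1 (c := 0)).
  by apply: closureS cz => y [y1 _] /=; rewrite subr0.
apply: closed_normsq_ge1.
by apply: closureS cz => y [_ /(_ n m nm)/ltW].
Qed.

Lemma pieces_sub_disk j z : disk_pieces j z -> normsq z <= 1.
Proof.
have [->/pieces0_sub[]//|/pieces_lens ->] := eqVneq j ord0.
by case.
Qed.

Lemma bigcup_pieces : \bigcup_j @disk_pieces R j = @cdisk R.
Proof.
apply/seteqP; split=> z; rewrite /cdisk /= norm_le1.
  by move=> [j _ /pieces_sub_disk].
move=> z1; have [[j jz]|nz] := pselect (exists j, j != ord0 /\ disk_pieces j z).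
  by exists j => //; case: jz.
exists ord0 => //; rewrite pieces0E; apply: subset_closure; split=> // n m.
move=> /unitv_center[j [j0 jE]]; rewrite ltNge; apply/negP => zj; apply: nz.
by exists j; split=> //; rewrite pieces_lens // jE.
Qed.

Lemma normsq_lat n m : normsq (lat n m) = ((n ^+ 2 + m ^+ 2) *+ 2)%:~R.
Proof.
rewrite /normsq /lat /= !(rmorphMn, rmorphD, rmorphB, rmorphXn, rmorphN) /=.
by ring.
Qed.

(* Distinct unit vectors are at distance at least 2, so their lenses meet at
   most in a point of tangency. *)
Lemma pieces_overlap i j : i != j ->
  exists n m, unitv n m /\
  forall z, disk_pieces i z -> disk_pieces j z -> normsq (z - lat n m) = 1.
Proof.
(* The claim is symmetric, and at most one of the two pieces is the central one. *)
wlog j0 : i j / j != ord0 => [H ij|].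
  have [jE|j0] := eqVneq j ord0; last exact: H.
  have i0 : i != ord0 by rewrite -jE.
  have [|n [m [nm E]]] := H j i i0; first by rewrite eq_sym.
  by exists n, m; split=> // z zi zj; apply: E.
move=> ij; exists (center j).1, (center j).2; split; first exact: center_unitv.
have [->|i0] := eqVneq i ord0 => z.
  move=> /pieces0_sub[_ /(_ _ _ (center_unitv j0)) ge1].
  by rewrite pieces_lens // => -[_ le1]; apply/eqP; rewrite eq_le le1.
rewrite !pieces_lens // => -[_ zi] [_ zj]; apply/eqP; rewrite eq_le zj /=.
rewrite leNgt; apply/negP => zj1; move: ij; rewrite -(inj_eq center_inj) => /eqP.
have := lat_near zj1 zi; move: (center_unitv i0) (center_unitv j0).
case: (center i) (center j) => [n m] [n' m'] /=.
by move=> /unitvP[] [-> ->] /unitvP[] [-> ->].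
Qed.

Lemma closed_pieces j : closed (@disk_pieces R j).
Proof.
have [->|/pieces_lens ->] := eqVneq j ord0.
  by rewrite pieces0E; exact: closed_closure.
have -> : lens (center j).1 (center j).2 = [set z | normsq (z - 0) <= 1] `&`
  [set z | normsq (z - lat (center j).1 (center j).2) <= 1].
  by apply/seteqP; split=> z; rewrite /lens /= subr0.
by apply: closedI; exact: closed_normsq_le1.
Qed.

(** Off [circles] the inequalities defining a piece are strict at each of its points, hence hold
    nearby, so the point is interior. *)
Lemma null_boundary_pieces j : Defs.null_set (Defs.boundary (@disk_pieces R j)).
Proof.
apply: null_circles => z [/closed_pieces zj iz]; apply: contrapT => zC; apply: iz.
have z1 : normsq (z - 0) < 1.
  by apply: (not_circles_lt (n := 0) (m := 0) zC);
    rewrite lat00 subr0 (pieces_sub_disk zj).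
have nbhs_z := open_nbhs_nbhs (conj (@open_normsq_lt1 0) z1).
rewrite /interior; have [jE|j0] := eqVneq j ord0.
  have gt1 n m : unitv n m -> nbhs z [set y | 1 < normsq (y - lat n m)].
    move=> nm; apply: open_nbhs_nbhs; split; first exact: open_normsq_gt1.
    move: zj; rewrite jE => /pieces0_sub[_ /(_ _ _ nm)] /=.
    by rewrite le_eqVlt => /orP[/eqP e|//]; case: zC; exists n, m.
  have u1 : unitv 1 0 by []. have u2 : unitv (-1) 0 by [].
  have u3 : unitv 0 1 by []. have u4 : unitv 0 (-1) by [].
  apply: filterS (filterI (filterI nbhs_z (filterI (gt1 _ _ u1) (gt1 _ _ u2)))
    (filterI (gt1 _ _ u3) (gt1 _ _ u4))) => y [[/= y1 [? ?]] [? ?]].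
  rewrite jE pieces0E; apply: subset_closure.
  by split=> [|n m /unitvP[] [-> ->] //]; rewrite -[y]subr0 ltW.
move: zj; rewrite pieces_lens // => -[_ /(not_circles_lt zC) zc].
apply: filterS (filterI nbhs_z
  (open_nbhs_nbhs (conj (@open_normsq_lt1 _) zc))) => y [/= y1 y2].
by split; rewrite ltW // -[y]subr0.
Qed.

Lemma finite_partition_pieces : finite_partition (@cdisk R) (@disk_pieces R).
Proof.
split; [exact: closed_pieces|exact: null_boundary_pieces| |exact: bigcup_pieces].
move=> i j /pieces_overlap[n [m [_ E]]]; exact: circle_interior_disjoint E.
Qed.

(** * Images of the pieces under the Gauss map *)

Lemma normsq_inv_le1 z n m : unitv n m -> z != 0 ->
  (normsq (- z^-1 - lat n m) <= 1) = (normsq (z - lat (- m) (- n)) <= 1).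
Proof.
move=> nm z0; rewrite -subr_le0 normsq_inv // pmulr_lle0 ?subr_le0 //.
by rewrite invr_gt0 lt_def normsq_eq0 z0 normsq_ge0.
Qed.

Lemma normsqV_ge1 z : z != 0 -> (1 <= normsq (- z^-1)) = (normsq z <= 1).
Proof.
by move=> z0; rewrite normsqV invf_ge1 // lt_def normsq_eq0 z0 normsq_ge0.
Qed.

Lemma normsqV_le1 z : z != 0 -> (normsq (- z^-1) <= 1) = (1 <= normsq z).
Proof.
by move=> z0; rewrite normsqV invf_le1 // lt_def normsq_eq0 z0 normsq_ge0.
Qed.

Lemma oppVK z : - (- z^-1)^-1 = z.
Proof. by rewrite invrN opprK invrK. Qed.

Lemma oppV_eq0 z : (- z^-1 == 0) = (z == 0).
Proof. by rewrite oppr_eq0 invr_eq0. Qed.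

Lemma unitvN n m : unitv (- m) (- n) <-> unitv n m.
Proof. by rewrite /unitv; lia. Qed.

Variables (floor : Cplx R -> Cplx R) (floorP : disk_algorithm floor).

Lemma floor_tile w : exists n m, floor w = lat n m /\ tile n m w.
Proof. by have [_ /tile_of_V] := floorP w. Qed.

(** Off [circles] all boundary conventions agree, by uniqueness of the tile. *)
Lemma floorE n m w : ~ circles w -> tile n m w -> floor w = lat n m.
Proof.
move=> wC tw; have [p [q [-> tw']]] := floor_tile w.
by have [-> ->] := tile_uniq wC tw tw'.
Qed.

Lemma gaussE z : z != 0 -> gauss_map floor z = - z^-1 - floor (- z^-1).
Proof. by move=> /negPf z0; rewrite /gauss_map z0. Qed.

Lemma gauss_disk z : normsq (gauss_map floor z) <= 1.
Proof.
rewrite /gauss_map; case: eqP => _; first by rewrite -norm_le1 normr0.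
by have [n [m [-> []]]] := floor_tile (- z^-1).
Qed.

(** The two points differ by a lattice vector, and lattice translations permute the circles. *)
Lemma circles_gauss z : z != 0 -> ~ circles (gauss_map floor z) ->
  ~ circles (- z^-1).
Proof.
move=> z0; apply: contra_not; rewrite gaussE //.
have [n [m [-> _]]] := floor_tile (- z^-1).
by move=> zC; apply: (@circlesD _ n m); rewrite subrK.
Qed.

(* [z |-> - z^-1] sends the lens at [lat n m] to the tile of [lat (- m) (- n)]. *)
Lemma gauss_lens n m v : unitv n m -> ~ circles v ->
  (gauss_map floor @` lens n m) v <->
  normsq v <= 1 /\ 1 <= normsq (v - lat m n).
Proof.
move=> nm vC; have mn : unitv (- m) (- n) by apply/unitvN.
split=> [[z [z1 zl] zv]|[v1 vl]].
  (* 0 has squared distance 2 from the centre of the lens. *)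
  have z0 : z != 0.
    apply: contraTneq zl => ->; rewrite sub0r -latN normsq_lat -ltNge.
    by case/unitvP: nm => [] [-> ->]; rewrite ltr1z.
  have tz : tile (- m) (- n) (- z^-1).
    by apply: tile1; rewrite ?normsqV_ge1 ?normsq_inv_le1 // !opprK.
  have fz : floor (- z^-1) = lat (- m) (- n).
    by apply: floorE tz; apply: circles_gauss => //; rewrite zv.
  rewrite -zv gauss_disk gaussE // fz latN opprK addrK normsqV_ge1 //.
(* [w] is [v] moved into the tile of [lat (- m) (- n)]; the preimage of [v] is then $-1/w$. *)
set w := v - lat m n; have vE : v = w + lat m n by rewrite subrK.
have wC : ~ circles w by move: vC; apply: contra_not; rewrite /w -latN; exact: circlesD.
have w0 : w != 0.
  by apply: contraTneq vl => w0; rewrite -/w w0 -norm_ge1 normr0 ler10.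
have z0 : - w^-1 != 0 by rewrite oppV_eq0.
have tw : tile (- m) (- n) w.
  by apply: tile1 => //; rewrite latN opprK -vE.
exists (- w^-1).
  split; first by rewrite normsqV_le1.
  by rewrite normsq_inv_le1 // latN opprK -vE.
by rewrite gaussE // oppVK (floorE wC tw) latN opprK -vE.
Qed.

(** The sum equals $2|v|^2+2|\alpha|^2$, and $|\alpha|^2=2$. *)
Lemma normsq_parallelogram v : 4 <= normsq (v - lat 1 0) + normsq (v - lat (-1) 0).
Proof.
case: v => x y; rewrite /lat !normsq_sub !(addr0, subr0) rmorphN rmorph1.
have := sqr_ge0 x; have := sqr_ge0 y; lra.
Qed.

Lemma gauss_core v : ~ circles v ->
  (gauss_map floor @` disk_pieces ord0) v <-> normsq v <= 1.
Proof.
move=> vC; split=> [[z _ <-]|v1]; first exact: gauss_disk.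
(* A sign for $u=\pm\alpha$ with $|v+u|\ge1$, so that $w=v+2u$ lies in the tile of $2u$. *)
have [n [m [nm vnm]]] : exists n m, unitv n m /\ 1 <= normsq (v + lat n m).
  have lN : lat (-1) 0 = - lat 1 0 by rewrite -latN oppr0.
  have [le1|lt1] := leP 1 (normsq (v - lat 1 0)).
    by exists (-1), 0; rewrite lN.
  exists 1, 0; split=> //.
  by move: (normsq_parallelogram v) lt1; rewrite lN opprK; lra.
set w := v + lat (n *+ 2) (m *+ 2).
have vE : v = w - lat (n *+ 2) (m *+ 2) by rewrite addrK.
have wC : ~ circles w by move/circlesD.
have tw : tile (n *+ 2) (m *+ 2) w.
  by apply: tile2 nm _ _; rewrite -?vE // /w !mulr2n latD addrA addrK.
have w1 : 1 < normsq w.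
  rewrite ltNge; apply/negP => /tile0 /(tile_uniq wC tw) [].
  by case/unitvP: nm => [] [-> ->].
have w0 : w != 0 by rewrite -normsq_eq0 gt_eqF // (lt_trans _ w1).
have z0 : - w^-1 != 0 by rewrite oppV_eq0.
exists (- w^-1); last by rewrite gaussE // oppVK (floorE wC tw) -vE.
rewrite pieces0E; apply: subset_closure; split; first by rewrite normsqV_le1 // ltW.
(* Were $-1/w$ in a lens, [w] would also lie in the tile of a unit vector, against uniqueness. *)
move=> p q pq; rewrite ltNge normsq_inv_le1 //; apply/negP.
move=> /(tile1 (proj2 (unitvN p q) pq) (ltW w1)) /(tile_uniq wC tw) [].
by case/unitvP: nm => [] [-> ->]; case/unitvP: pq => [] [-> ->].
Qed.

Lemma gauss_buildable j :
  buildable (range (@disk_pieces R)) (gauss_map floor @` disk_pieces j).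
Proof.
have [->|j0] := eqVneq j ord0.
  exists (range (@disk_pieces R)) => //; apply: null_setY => v vC.
  rewrite gauss_core // bigcup_image bigcup_pieces /cdisk /= norm_le1.
  by [].
have cj := center_unitv j0; rewrite pieces_lens //.
move: cj; case: (center j) => n m /= nm.
(* [lat m n] is the conjugate of [lat n m]; its lens [k] is the only piece missing from the
   image. *)
have [|k [k0 kE]] := @unitv_center m n; first by rewrite /unitv addnC.
exists (@disk_pieces R @` [set~ k]) => [_ [i _ <-]|]; first by exists i.
apply: null_setY => v vC; rewrite gauss_lens // bigcup_image.
split=> [[v1 vl]|[i /= /eqP ik vi]].
  have : (\bigcup_j @disk_pieces R j) v.
    by rewrite bigcup_pieces /cdisk /= norm_le1.
  case=> i _ vi; exists i => //= ik; move: vi; rewrite ik pieces_lens // kE.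
  by move=> [_ /(not_circles_lt vC)]; rewrite ltNge vl.
split; first exact: pieces_sub_disk vi.
(* Otherwise [v] lies in two distinct pieces, hence on a circle. *)
rewrite leNgt; apply/negP => vl; have [p [q [_ E]]] := pieces_overlap ik.
apply: vC; exists p, q; apply: E => //.
by rewrite pieces_lens // kE; split; [exact: pieces_sub_disk vi|exact: ltW].
Qed.

End DiskAlgorithm.

Theorem proposition4p10 (R : realType) (floor : Cplx R -> Cplx R)
    (hfloor : disk_algorithm floor) :
  finite_building_property (@cdisk R) floor (@disk_pieces R).
Proof.
split=> //; first exact: finite_partition_pieces.
exact: gauss_buildable.
Qed.
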